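(* Let $\varphi_1,\varphi_2,\varphi_3\in\mathbb{R}$ be such that $\sin(\varphi_k)\neq0$, $\cos(\varphi_k)\ne0$ and $\cos(\varphi_\ell-\varphi_m)\neq0$ for every cyclic permutation $(k,\ell,m)$ of $(1,2,3)$, and let $\mathbf{u}=(e^{i\varphi_1},e^{i\varphi_2},e^{i\varphi_3})$. Then there are non-zero complex scalars $s^0,s^1,s^2,s^3$ with $$s^0s^k\cos(\varphi_\ell-\varphi_m)+s^\ell s^m\sin(\varphi_k)=0$$ for every cyclic permutation $(k,\ell,m)$ of $(1,2,3)$, and in terms of $S_\mu=s^\mu x^\mu$ the defining relations of $C_{\mathrm{alg}}(\mathbb{R}^4_{\mathbf{u}})$ can be written $$[S_0,S_k]_-=iJ_{\ell m}[S_\ell,S_m]_+,\qquad [S_\ell,S_m]_-=i[S_0,S_k]_+,$$ where $J_{\ell m}=-\tan(\varphi_\ell-\varphi_m)\tan(\varphi_k)$ for every cyclic permutation $(k,\ell,m)$ of $(1,2,3)$. The three real numbers $J_{12},J_{23},J_{31}$ satisfy $$J_{12}+J_{23}+J_{31}+J_{12}J_{23}J_{31}=0,$$ so that $C_{\mathrm{alg}}(\mathbb{R}^4_{\mathbf{u}})$ is isomorphic, as a complex algebra, to the Sklyanin algebra with constants $J_{12},J_{23},J_{31}$.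
   Context: $C_{\mathrm{alg}}(\mathbb{R}^4_{\mathbf{u}})$ is the complex unital algebra generated by $x^0,x^1,x^2,x^3$ with relations $$\cos(\varphi_k)[x^0,x^k]_-=i\sin(\varphi_\ell-\varphi_m)[x^\ell,x^m]_+,\qquad \cos(\varphi_\ell-\varphi_m)[x^\ell,x^m]_-=-i\sin(\varphi_k)[x^0,x^k]_+$$ for every cyclic permutation $(k,\ell,m)$ of $(1,2,3)$, where $[x,y]_\pm=xy\pm yx$. The Sklyanin algebra with constants $J_{12},J_{23},J_{31}$ satisfying $J_{12}+J_{23}+J_{31}+J_{12}J_{23}J_{31}=0$ is the complex unital algebra generated by $S_0,S_1,S_2,S_3$ with relations $[S_0,S_k]_-=iJ_{\ell m}[S_\ell,S_m]_+$ and $[S_\ell,S_m]_-=i[S_0,S_k]_+$ for every cyclic permutation $(k,\ell,m)$ of $(1,2,3)$. *)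

(* Defs.v *)
From HB Require Import structures.
From mathcomp Require Import all_boot all_order all_algebra.
From mathcomp Require Import finmap complex.
From mathcomp Require Import all_classical all_reals all_analysis.
From mathcomp Require monalg.
(* The notations of monalg are incompatible with those of mathcomp-analysis. *)
Import -(notations) monalg.

Set Implicit Arguments.
Unset Strict Implicit.
Unset Printing Implicit Defensive.
Import Order.TTheory GRing.Theory Num.Theory.
Local Open Scope classical_set_scope.
Local Open Scope quotient_scope.
Local Open Scope ring_scope.
Local Open Scope complex_scope.

Section FreeAlgebra.
Context (F : comNzRingType) (I : choiceType).

(* Noncommutative polynomials: finite F-linear combinations of words in I. *)
Definition freealg : Type := malg (fmonom I) F.
Local Notation M := (malg (fmonom I) F).

HB.instance Definition _ := Choice.copy freealg M.

(* The operations of M, locked so that failing conversions stay cheap. *)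
Let add : freealg -> freealg -> freealg := locked (@GRing.add M).
Let opp : freealg -> freealg := locked (@GRing.opp M).
Let mul : freealg -> freealg -> freealg := locked (@GRing.mul M).
Let scale : F -> freealg -> freealg := locked (@GRing.scale F M).
Let zero : freealg := locked (0 : M).
Let one : freealg := locked (1 : M).

Let addA : associative add. Proof. by rewrite /add -lock; exact: addrA. Qed.
Let addC : commutative add. Proof. by rewrite /add -lock; exact: addrC. Qed.
Let add0 : left_id zero add.
Proof. by rewrite /add /zero -!lock; exact: add0r. Qed.
Let addN : left_inverse zero opp add.
Proof. by rewrite /add /zero /opp -!lock; exact: addNr. Qed.

HB.instance Definition _ := GRing.isZmodule.Build freealg addA addC add0 addN.

Let mulA : associative mul. Proof. by rewrite /mul -lock; exact: mulrA. Qed.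
Let mul1 : left_id one mul.
Proof. by rewrite /mul /one -!lock; exact: mul1r. Qed.
Let mul1' : right_id one mul.
Proof. by rewrite /mul /one -!lock; exact: mulr1. Qed.
Let mulDl : left_distributive mul add.
Proof. by rewrite /mul /add -!lock; exact: mulrDl. Qed.
Let mulDr : right_distributive mul add.
Proof. by rewrite /mul /add -!lock; exact: mulrDr. Qed.
Let one_neq0 : one != zero.
Proof. by rewrite /one /zero -!lock; exact: (@oner_neq0 M). Qed.

HB.instance Definition _ :=
  GRing.Zmodule_isNzRing.Build freealg mulA mul1 mul1' mulDl mulDr one_neq0.

Let scaleA c d a : scale c (scale d a) = scale (c * d) a.
Proof. by rewrite /scale -lock; exact: scalerA. Qed.
Let scale1 : left_id 1 scale.
Proof. by rewrite /scale -lock; exact: scale1r. Qed.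
Let scaleDr : right_distributive scale add.
Proof. by rewrite /scale /add -!lock; exact: scalerDr. Qed.
Let scaleDl a : {morph scale^~ a : c d / c + d >-> add c d}.
Proof. by rewrite /scale /add -!lock; exact: scalerDl. Qed.

HB.instance Definition _ :=
  GRing.Zmodule_isLmodule.Build F freealg scaleA scale1 scaleDr scaleDl.

Let scaleAl (c : F) (a b : freealg) : scale c (mul a b) = mul (scale c a) b.
Proof. by rewrite /scale /mul -!lock; exact: scalerAl. Qed.
Let scaleAr (c : F) (a b : freealg) : scale c (mul a b) = mul a (scale c b).
Proof.
rewrite /scale /mul -!lock.
rewrite [RHS](fgmullw (fsubset_refl (msupp (a : M))) (msuppZ_le c (b : M))).
rewrite [X in _ *: X]fgmull scaler_sumr; apply: eq_bigr => k1 _.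
rewrite scaler_sumr; apply: eq_bigr => k2 _; apply/malgP => m.
by rewrite !mcoeffZ !mcoeffU mulrCA mulrnAr.
Qed.

HB.instance Definition _ := GRing.Lmodule_isLalgebra.Build F freealg scaleAl.
HB.instance Definition _ := GRing.Lalgebra_isAlgebra.Build F freealg scaleAr.

Definition freegen (i : I) : freealg := locked (mkmalgU (fmu i) 1 : M).

Lemma freealg_addE (a b : freealg) : a + b = ((a : M) + (b : M) : M).
Proof. by rewrite {1}/GRing.add /= /add -lock. Qed.
Lemma freealg_oppE (a : freealg) : - a = (- (a : M) : M).
Proof. by rewrite {1}/GRing.opp /= /opp -lock. Qed.
Lemma freealg_mulE (a b : freealg) : a * b = ((a : M) * (b : M) : M).
Proof. by rewrite {1}/GRing.mul /= /mul -lock. Qed.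
Lemma freealg_scaleE (c : F) (a : freealg) : c *: a = (c *: (a : M) : M).
Proof. by rewrite {1}/GRing.scale /= /scale -lock. Qed.
Lemma freealg_zeroE : (0 : freealg) = (0 : M).
Proof. by rewrite {1}/GRing.zero /= /zero -lock. Qed.
Lemma freealg_oneE : (1 : freealg) = (1 : M).
Proof. by rewrite {1}/GRing.one /= /one -lock. Qed.
Lemma freegenE (i : I) : freegen i = (mkmalgU (fmu i) 1 : M).
Proof. by rewrite /freegen -lock. Qed.

(* The constant coefficient. *)
Definition freeaug : freealg -> F := locked (@mcoeff (fmonom I) F mone).

Lemma freeaug0 : freeaug 0 = 0.
Proof. by rewrite /freeaug -lock freealg_zeroE; exact: mcoeff0. Qed.
Lemma freeaug1 : freeaug 1 = 1.
Proof. by rewrite /freeaug -lock freealg_oneE; exact: rmorph1. Qed.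
Lemma freeaugD a b : freeaug (a + b) = freeaug a + freeaug b.
Proof. by rewrite /freeaug -lock freealg_addE; exact: mcoeffD. Qed.
Lemma freeaugB a b : freeaug (a - b) = freeaug a - freeaug b.
Proof.
rewrite freeaugD; congr (_ + _).
by rewrite /freeaug -lock freealg_oppE; exact: mcoeffN.
Qed.
Lemma freeaugM a b : freeaug (a * b) = freeaug a * freeaug b.
Proof. by rewrite /freeaug -lock freealg_mulE; exact: rmorphM. Qed.
Lemma freeaugZ c a : freeaug (c *: a) = c * freeaug a.
Proof. by rewrite /freeaug -lock freealg_scaleE; exact: mcoeffZ. Qed.
Lemma freeaug_gen i : freeaug (freegen i) = 0.
Proof. by rewrite /freeaug -lock freegenE mcoeffU fm1_eq1. Qed.

End FreeAlgebra.
Definition two_sided_ideal (A : pzRingType) (J : set A) : Prop :=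
  [/\ J 0, (forall a b, J a -> J b -> J (a - b)) &
      (forall a b c, J b -> J (a * b * c))].

(* A relation  lhs = rhs  is represented by the pair (lhs, rhs). *)
Definition relation_ideal (A : pzRingType) (rels : set (A * A)) : set A :=
  smallest (@two_sided_ideal A) [set p.1 - p.2 | p in rels].

Lemma relation_idealP (A : pzRingType) (rels : set (A * A)) :
  two_sided_ideal (relation_ideal rels).
Proof.
split=> [J [[J0 _ _] _] //|a b Ia Ib J HJ|a b c Ib J HJ].
- by have [[_ JB _] _] := HJ; apply: JB; [apply: Ia|apply: Ib].
- by have [[_ _ JM] _] := HJ; apply: JM; apply: Ib.
Qed.

Section QuotientAlgebra.
Context (F : comNzRingType) (A : algType F) (rels : set (A * A)).
Implicit Types a b : A.

Let J := relation_ideal rels.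

Definition eqmod_rel a b : bool := `[< relation_ideal rels (a - b) >].

Let J0 : J 0. Proof. by have [] := relation_idealP rels. Qed.
Let JB a b : J a -> J b -> J (a - b).
Proof. by have [_ + _] := relation_idealP rels; apply. Qed.
Let JM a b c : J b -> J (a * b * c).
Proof. by have [_ _] := relation_idealP rels; apply. Qed.
Let JN a : J a -> J (- a).
Proof. by move=> Ja; rewrite -sub0r; apply: JB. Qed.
Let JD a b : J a -> J b -> J (a + b).
Proof. by move=> Ja Jb; rewrite -[b]opprK; apply: JB => //; apply: JN. Qed.

Let eqmod_refl : reflexive eqmod_rel.
Proof. by move=> a; apply/asboolP; rewrite subrr; exact: J0. Qed.
Let eqmod_sym : symmetric eqmod_rel.
Proof.
by move=> a b; rewrite /eqmod_rel; congr `[< _ >]; apply/propext;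
  split=> /JN; rewrite opprB; exact.
Qed.
Let eqmod_trans : transitive eqmod_rel.
Proof.
move=> b a c /asboolP ab /asboolP bc; apply/asboolP.
by rewrite -(subrKA b); exact: JD.
Qed.

Canonical eqmod_equiv := EquivRel eqmod_rel eqmod_refl eqmod_sym eqmod_trans.

(* The quotient of A by the two-sided ideal generated by the relations. Algebras
   are nonzero in the library, whence the side condition. *)
Definition quotalg (_ : ~ relation_ideal rels 1) : Type :=
  {eq_quot eqmod_rel}.

Context (proper : ~ relation_ideal rels 1).
Local Notation Q := (quotalg proper).

HB.instance Definition _ := Choice.on Q.
HB.instance Definition _ := EqQuotient.on Q.

Definition quotalg_pi (a : A) : Q := \pi_(Q) a.

Let piP a b : reflect (J (a - b)) (quotalg_pi a == quotalg_pi b).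
Proof. by rewrite /quotalg_pi eqmodE; exact: asboolP. Qed.
Let piE a b : J (a - b) -> quotalg_pi a = quotalg_pi b.
Proof. by move/piP/eqP. Qed.
Let reprE a : J (repr (quotalg_pi a) - a).
Proof. by apply/piP; rewrite /quotalg_pi reprK. Qed.

Let add (x y : Q) := quotalg_pi (repr x + repr y).
Let opp (x : Q) := quotalg_pi (- repr x).
Let mul (x y : Q) := quotalg_pi (repr x * repr y).
Let scale (c : F) (x : Q) := quotalg_pi (c *: repr x).

Let quotW (P : Q -> Prop) : (forall a, P (quotalg_pi a)) -> forall x, P x.
Proof. by move=> Ppi x; rewrite -[x]reprK; apply: Ppi. Qed.

Let addE a b : add (quotalg_pi a) (quotalg_pi b) = quotalg_pi (a + b).
Proof. by apply: piE; rewrite opprD addrACA; apply: JD; apply: reprE. Qed.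
Let oppE a : opp (quotalg_pi a) = quotalg_pi (- a).
Proof. by apply: piE; rewrite -opprD; apply: JN; apply: reprE. Qed.
Let mulE a b : mul (quotalg_pi a) (quotalg_pi b) = quotalg_pi (a * b).
Proof.
apply: piE; rewrite -(subrKA (a * repr (quotalg_pi b))) -mulrBl -mulrBr.
apply: JD; first by rewrite -[_ * _]mul1r mulrA; apply: JM; apply: reprE.
by rewrite -[_ * _]mulr1; apply: JM; apply: reprE.
Qed.
Let scaleE c a : scale c (quotalg_pi a) = quotalg_pi (c *: a).
Proof.
apply: piE; rewrite -scalerBr -[_ - a]mul1r scalerAl -[_ * _]mulr1.
by apply: JM; apply: reprE.
Qed.

Let addA : associative add.
Proof.
by elim/quotW => a; elim/quotW => b; elim/quotW => c; rewrite !addE addrA.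
Qed.
Let addC : commutative add.
Proof. by elim/quotW => a; elim/quotW => b; rewrite !addE addrC. Qed.
Let add0 : left_id (quotalg_pi 0) add.
Proof. by elim/quotW => a; rewrite addE add0r. Qed.
Let addN : left_inverse (quotalg_pi 0) opp add.
Proof. by elim/quotW => a; rewrite oppE addE addNr. Qed.

HB.instance Definition _ := GRing.isZmodule.Build Q addA addC add0 addN.

Let addqE a b : quotalg_pi a + quotalg_pi b = quotalg_pi (a + b).
Proof. exact: addE. Qed.

Let mulA : associative mul.
Proof.
by elim/quotW => a; elim/quotW => b; elim/quotW => c; rewrite !mulE mulrA.
Qed.
Let mul1 : left_id (quotalg_pi 1) mul.
Proof. by elim/quotW => a; rewrite mulE mul1r. Qed.
Let mul1' : right_id (quotalg_pi 1) mul.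
Proof. by elim/quotW => a; rewrite mulE mulr1. Qed.
Let mulDl : left_distributive mul +%R.
Proof.
elim/quotW => a; elim/quotW => b; elim/quotW => c.
by rewrite !(mulE, addqE) mulrDl.
Qed.
Let mulDr : right_distributive mul +%R.
Proof.
elim/quotW => a; elim/quotW => b; elim/quotW => c.
by rewrite !(mulE, addqE) mulrDr.
Qed.

Let pi1_neq0 : quotalg_pi 1 != 0.
Proof. by apply/piP; rewrite subr0. Qed.

HB.instance Definition _ :=
  GRing.Zmodule_isNzRing.Build Q mulA mul1 mul1' mulDl mulDr pi1_neq0.

Let mulqE a b : quotalg_pi a * quotalg_pi b = quotalg_pi (a * b).
Proof. exact: mulE. Qed.

Let scaleA c d x : scale c (scale d x) = scale (c * d) x.
Proof. by elim/quotW: x => a; rewrite !scaleE scalerA. Qed.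
Let scale1 : left_id 1 scale.
Proof. by elim/quotW => a; rewrite scaleE scale1r. Qed.
Let scaleDr : right_distributive scale +%R.
Proof.
move=> c; elim/quotW => a; elim/quotW => b.
by rewrite !(scaleE, addqE) scalerDr.
Qed.
Let scaleDl x : {morph scale^~ x : c d / c + d}.
Proof.
elim/quotW: x => a c d.
by rewrite !scaleE addqE scalerDl.
Qed.

HB.instance Definition _ :=
  GRing.Zmodule_isLmodule.Build F Q scaleA scale1 scaleDr scaleDl.

Let scaleqE c a : c *: quotalg_pi a = quotalg_pi (c *: a).
Proof. exact: scaleE. Qed.

Let scaleAl (c : F) (x y : Q) : c *: (x * y) = (c *: x) * y.
Proof.
elim/quotW: x => a; elim/quotW: y => b.
by rewrite mulqE !scaleqE mulqE scalerAl.
Qed.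
Let scaleAr (c : F) (x y : Q) : c *: (x * y) = x * (c *: y).
Proof.
elim/quotW: x => a; elim/quotW: y => b.
by rewrite mulqE !scaleqE mulqE scalerAr.
Qed.

HB.instance Definition _ :=
  GRing.Lmodule_isLalgebra.Build F Q scaleAl.
HB.instance Definition _ :=
  GRing.Lalgebra_isAlgebra.Build F Q scaleAr.

Lemma quotalg_pi_additive : {morph quotalg_pi : a b / a - b}.
Proof.
by move=> a b; rewrite -[RHS]/(add _ (opp _)) oppE addE.
Qed.
Lemma quotalg_pi_multiplicative : monoid_morphism quotalg_pi.
Proof. by split=> // a b; rewrite mulqE. Qed.
Lemma quotalg_pi_scalable : scalable quotalg_pi.
Proof. by move=> c a; rewrite scaleqE. Qed.

HB.instance Definition _ :=
  GRing.isZmodMorphism.Build A Q quotalg_pi quotalg_pi_additive.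
HB.instance Definition _ :=
  GRing.isMonoidMorphism.Build A Q quotalg_pi quotalg_pi_multiplicative.
HB.instance Definition _ :=
  GRing.isScalable.Build F A Q *:%R quotalg_pi quotalg_pi_scalable.

Lemma quotalg_pi_eq a b :
  quotalg_pi a = quotalg_pi b <-> relation_ideal rels (a - b).
Proof. by split=> [ab|/piE//]; apply/piP/eqP. Qed.

Lemma quotalg_piW (P : Q -> Prop) :
  (forall a, P (quotalg_pi a)) -> forall x, P x.
Proof. exact: quotW. Qed.

End QuotientAlgebra.

Lemma relation_ideal_proper (F : comNzRingType) (I : choiceType)
    (rels : set (freealg F I * freealg F I)) :
  (forall r, rels r -> freeaug r.1 = freeaug r.2) ->
  ~ relation_ideal rels 1.
Proof.
move=> rels0 I1.
suff : freeaug (1 : freealg F I) = 0.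
  by rewrite freeaug1; apply/eqP; exact: oner_neq0.
apply: (I1 [set a : freealg F I | freeaug a = 0]); split.
  split=> [|a b /= ea eb|a b c /= eb]; first by rewrite /= freeaug0.
  - by rewrite freeaugB ea eb subrr.
  - by rewrite !freeaugM eb mulr0 mul0r.
by move=> _ [r /rels0 e <-]; rewrite /= freeaugB e subrr.
Qed.

Definition holds (A : Type) (r : A * A) : Prop := r.1 = r.2.

Definition commm (A : pzRingType) (a b : A) : A := a * b - b * a.
Definition commp (A : pzRingType) (a b : A) : A := a * b + b * a.

Section FreeCommutators.
Context (F : comNzRingType) (I : choiceType).

Lemma freeaug_commm (i j : I) : freeaug (commm (freegen F i) (freegen F j)) = 0.
Proof. by rewrite freeaugB !freeaugM !freeaug_gen mulr0 subrr. Qed.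

Lemma freeaug_commp (i j : I) : freeaug (commp (freegen F i) (freegen F j)) = 0.
Proof. by rewrite freeaugD !freeaugM !freeaug_gen mulr0 addr0. Qed.

End FreeCommutators.

(* The index set {1, 2, 3} is 'I_3, whose element i stands for i + 1; addition
   in 'I_3 is modulo 3. *)
Definition cyclic_perm (k l m : 'I_3) : Prop := l = k + 1 /\ m = k + 2.

(* The generators x^0, x^1, x^2, x^3 are indexed by 'I_4; [lift ord0] shifts
   'I_3 onto the nonzero elements of 'I_4. *)
Definition spatial (k : 'I_3) : 'I_4 := lift ord0 k.

Section Relations.
Context (R : realType) (A : algType R[i]).

Definition R4u_rel1 (phi : 'I_3 -> R) (x : 'I_4 -> A) (k l m : 'I_3) : A * A :=
  ((cos (phi k))%:C *: commm (x 0) (x (spatial k)),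
   ('i%C * (sin (phi l - phi m))%:C) *: commp (x (spatial l)) (x (spatial m))).

Definition R4u_rel2 (phi : 'I_3 -> R) (x : 'I_4 -> A) (k l m : 'I_3) : A * A :=
  ((cos (phi l - phi m))%:C *: commm (x (spatial l)) (x (spatial m)),
   (- ('i%C * (sin (phi k))%:C)) *: commp (x 0) (x (spatial k))).

(* Only the values J l m with (l, m) = (1, 2), (2, 3), (3, 1) are used. *)
Definition sklyanin_rel1 (J : 'I_3 -> 'I_3 -> R[i]) (S : 'I_4 -> A)
    (k l m : 'I_3) : A * A :=
  (commm (S 0) (S (spatial k)), ('i%C * J l m) *: commp (S (spatial l)) (S (spatial m))).

Definition sklyanin_rel2 (S : 'I_4 -> A) (k l m : 'I_3) : A * A :=
  (commm (S (spatial l)) (S (spatial m)), 'i%C *: commp (S 0) (S (spatial k))).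

End Relations.

Section Algebras.
Context (R : realType).

Definition R4u_rels (phi : 'I_3 -> R) :
    set (freealg R[i] 'I_4 * freealg R[i] 'I_4) :=
  [set r | exists k l m, cyclic_perm k l m /\
     (r = R4u_rel1 phi (@freegen _ _) k l m \/
      r = R4u_rel2 phi (@freegen _ _) k l m)].

Lemma R4u_proper (phi : 'I_3 -> R) : ~ relation_ideal (R4u_rels phi) 1.
Proof.
apply: relation_ideal_proper => _ [k [l [m [_ [->|->]]]]];
  by rewrite !freeaugZ freeaug_commm freeaug_commp !mulr0.
Qed.

(* C_alg(R^4_u) for u = (e^{i phi_1}, e^{i phi_2}, e^{i phi_3}): by
   [R4u_rels_torus] below it only depends on u. *)
Definition C_alg (phi : 'I_3 -> R) : algType R[i] := quotalg (@R4u_proper phi).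

Definition C_alg_gen (phi : 'I_3 -> R) (mu : 'I_4) : C_alg phi :=
  quotalg_pi (@R4u_proper phi) (freegen R[i] mu).

Definition sklyanin_rels (J : 'I_3 -> 'I_3 -> R[i]) :
    set (freealg R[i] 'I_4 * freealg R[i] 'I_4) :=
  [set r | exists k l m, cyclic_perm k l m /\
     (r = sklyanin_rel1 J (@freegen _ _) k l m \/
      r = sklyanin_rel2 (@freegen _ _) k l m)].

Lemma sklyanin_proper (J : 'I_3 -> 'I_3 -> R[i]) :
  ~ relation_ideal (sklyanin_rels J) 1.
Proof.
apply: relation_ideal_proper => _ [k [l [m [_ [->|->]]]]];
  by rewrite freeaugZ freeaug_commm freeaug_commp mulr0.
Qed.

Definition sklyanin (J : 'I_3 -> 'I_3 -> R[i]) : algType R[i] :=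
  quotalg (@sklyanin_proper J).

Definition sklyanin_gen (J : 'I_3 -> 'I_3 -> R[i]) (mu : 'I_4) : sklyanin J :=
  quotalg_pi (@sklyanin_proper J) (freegen R[i] mu).

Lemma R4u_rels_torus (phi psi : 'I_3 -> R) :
  (forall k, cos (phi k) +i* sin (phi k) = cos (psi k) +i* sin (psi k)) ->
  R4u_rels phi = R4u_rels psi.
Proof.
move=> e.
have c k : cos (phi k) = cos (psi k) by case: (e k).
have s k : sin (phi k) = sin (psi k) by case: (e k).
have E1 k l m (x : 'I_4 -> freealg R[i] 'I_4) :
    R4u_rel1 phi x k l m = R4u_rel1 psi x k l m.
  by rewrite /R4u_rel1 !sinB !c !s.
have E2 k l m (x : 'I_4 -> freealg R[i] 'I_4) :
    R4u_rel2 phi x k l m = R4u_rel2 psi x k l m.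
  by rewrite /R4u_rel2 !cosB !c !s.
by apply/seteqP; split=> r [k [l [m [klm H]]]]; exists k, l, m;
  split=> //; move: H; rewrite E1 E2.
Qed.

End Algebras.

(* Main.v *)
(** Rescaling the generators turns one presentation into the other, so by the
   universal property of algebras given by generators and relations the
   rescaling and its inverse induce mutually inverse morphisms.  With
   [t_k ^ 2 = - sin phi_k / cos (phi_l - phi_m)], the scalars [s^k = t_k] and
   [s^0 = t_1 t_2 t_3] satisfy [s^0 s^k = t_k ^ 2 s^l s^m], which is the
   required equation. *)
Require Import Defs.
From HB Require Import structures.
From mathcomp Require Import all_boot all_order all_algebra.
From mathcomp Require Import complex.
From mathcomp Require Import all_classical all_reals all_analysis.
From mathcomp Require Import ring.
From mathcomp Require monalg.
Import -(notations) monalg.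

Set Implicit Arguments.
Unset Strict Implicit.
Unset Printing Implicit Defensive.
Import Order.TTheory GRing.Theory Num.Theory.
Local Open Scope ring_scope.
Local Open Scope complex_scope.

(** * Universal property of the free algebra *)

Section FreeAlgebraUniversal.
Context (F : comNzRingType) (I : choiceType) (A : algType F).
Local Notation M := (malg (fmonom I) F).

Section Lift.
Variable x : I -> A.

Definition word_eval (w : fmonom I) : A := \prod_(i <- fmonom_val w) x i.

Lemma word_eval_mmorphism : mmorphism word_eval.
Proof.
split=> [v w|]; rewrite /word_eval ?fm1 ?big_nil //.
by rewrite fmM big_cat.
Qed.

HB.instance Definition _ :=
  isMultiplicative.Build (fmonom I) A word_eval word_eval_mmorphism.

Definition freelift (a : freealg F I) : A :=
  mmap (in_alg A) word_eval (a : M).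

Lemma freelift_zmod_morphism : zmod_morphism freelift.
Proof.
move=> a b; rewrite /freelift freealg_addE freealg_oppE.
exact: (mmapB (a : M) (b : M)).
Qed.

Lemma freelift_monoid_morphism : monoid_morphism freelift.
Proof.
(* Multiplicativity of the evaluation requires the images of coefficients to commute with evaluated
   words; they do, because scalar multiples of 1 are central. *)
have [|m1 mM] := @commr_mmap_is_multiplicative _ _ _ (in_alg A) word_eval.
  by move=> a v w; rewrite /GRing.comm /= mulr_algl mulr_algr.
split=> [|a b]; rewrite /freelift ?freealg_oneE ?freealg_mulE.
  exact: mmap1.
exact: m1.
Qed.

Lemma freelift_scalable : scalable freelift.
Proof.
move=> c a; rewrite /freelift freealg_scaleE.
by rewrite (mmapZ c (a : M)) mulr_algl.
Qed.

HB.instance Definition _ :=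
  GRing.isZmodMorphism.Build (freealg F I) A freelift freelift_zmod_morphism.
HB.instance Definition _ :=
  GRing.isMonoidMorphism.Build (freealg F I) A freelift
    freelift_monoid_morphism.
HB.instance Definition _ :=
  GRing.isScalable.Build F (freealg F I) A *:%R freelift freelift_scalable.

Lemma freelift_gen i : freelift (freegen F i) = x i.
Proof.
by rewrite /freelift freegenE mmapU /= scale1r mul1r /word_eval fmU big_seq1.
Qed.

End Lift.

(** Turns basis elements into products of generators, on which a morphism can be computed. *)
Lemma freealg_monomE (s : seq I) (c : F) :
  (mkmalgU (FMonom s) c : freealg F I) = c *: \prod_(i <- s) freegen F i.
Proof.
have -> : \prod_(i <- s) freegen F i = (mkmalgU (FMonom s) 1 : M).
  elim: s => [|i s IH]; rewrite ?big_nil ?big_cons.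
    by rewrite freealg_oneE; congr mkmalgU; apply/eqP; rewrite fmP fm1.
  rewrite IH freealg_mulE freegenE [RHS]/=.
  apply: etrans (@fgmulUU _ _ 1 1 _ _) _.
  rewrite mulr1; congr mkmalgU; apply/eqP.
  by rewrite fmP fmM fmU.
rewrite freealg_scaleE; apply/malgP => w.
by rewrite mcoeffZ !mcoeffU mulr_natr.
Qed.

(** Every element is a finite sum of monomials, and agreement on generators passes to products,
    scalar multiples and sums. *)
Lemma freealg_lrmorph_ext (f g : {lrmorphism freealg F I -> A}) :
  (forall i, f (freegen F i) = g (freegen F i)) -> f =1 g.
Proof.
move=> fg a; rewrite [a](monalgE (a : M)).
pose P (b : M) := f b = g b.
apply: (big_ind P) => [|b c Pb Pc|[s] _]; rewrite /P.
- by rewrite -freealg_zeroE !rmorph0.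
- by rewrite -(freealg_addE b c) !rmorphD; congr (_ + _).
- rewrite freealg_monomE !linearZ !rmorph_prod; congr (_ *: _).
  by apply: eq_bigr => i _; exact: fg.
Qed.

End FreeAlgebraUniversal.

(** * Universal property of the quotient by a relation ideal *)

Section QuotientUniversal.
Context (F : comNzRingType) (A B : algType F) (rels : set (A * A)).
Context (proper : ~ relation_ideal rels 1).
Local Notation Q := (quotalg proper).

Lemma quotalg_pi_rel r : rels r ->
  quotalg_pi proper r.1 = quotalg_pi proper r.2.
Proof. by move=> rr; apply/quotalg_pi_eq => J [_]; apply; exists r. Qed.

(** The kernel of [f] is a two-sided ideal containing the generating differences, and the relation
    ideal is the smallest such ideal. *)
Lemma relation_ideal_ker (f : {lrmorphism A -> B}) (a : A) :
  (forall r, rels r -> f r.1 = f r.2) -> relation_ideal rels a -> f a = 0.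
Proof.
move=> fr; apply: (_ : smallest _ _ `<=` [set b | f b = 0])%classic.
apply: smallest_sub => [|_ [r /fr e <-] /=]; last by rewrite rmorphB /= e subrr.
split=> [|b c /= fb fc|b c d /= fc]; first by rewrite /= rmorph0.
  by rewrite rmorphB /= fb fc subrr.
by rewrite !rmorphM /= fc mulr0 mul0r.
Qed.

Section Lift.
Variables (f : {lrmorphism A -> B}) (fr : forall r, rels r -> f r.1 = f r.2).

Let lift (q : Q) : B := f (repr q).

(** The chosen representative of the class of [a] differs from [a] by an element of the relation
    ideal, where [f] vanishes. *)
Let liftE a : lift (quotalg_pi proper a) = f a.
Proof.
apply/subr0_eq; rewrite -rmorphB; apply: relation_ideal_ker => //.
by apply/(quotalg_pi_eq proper); rewrite [LHS]reprK.
Qed.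

Let liftB : zmod_morphism lift.
Proof.
elim/quotalg_piW => a; elim/quotalg_piW => b.
by rewrite -rmorphB !liftE rmorphB.
Qed.

Let liftM : monoid_morphism lift.
Proof.
split; first by rewrite -(rmorph1 (quotalg_pi proper)) liftE rmorph1.
elim/quotalg_piW => a; elim/quotalg_piW => b.
by rewrite -rmorphM !liftE rmorphM.
Qed.

Let liftZ : scalable lift.
Proof. by move=> c; elim/quotalg_piW => a; rewrite -linearZ !liftE linearZ. Qed.

Lemma quotalg_lift :
  exists g : {lrmorphism Q -> B}, forall a, g (quotalg_pi proper a) = f a.
Proof.
pose zM := GRing.isZmodMorphism.Build Q B lift liftB.
pose mM := GRing.isMonoidMorphism.Build Q B lift liftM.
pose sM := GRing.isScalable.Build F Q B *:%R lift liftZ.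
pose g : {lrmorphism Q -> B} := HB.pack lift zM mM sM.
by exists g.
Qed.

End Lift.
End QuotientUniversal.

(** * Algebras given by generators and relations *)

Section FreeQuotient.
Context (F : comNzRingType) (I : choiceType) (A : algType F).
Context (rels : set (freealg F I * freealg F I)).
Context (proper : ~ relation_ideal rels 1).
Local Notation Q := (quotalg proper).

Lemma free_quotalg_lift (x : I -> A) :
  (forall r, rels r -> freelift x r.1 = freelift x r.2) ->
  exists g : {lrmorphism Q -> A},
    forall i, g (quotalg_pi proper (freegen F i)) = x i.
Proof.
move=> /(quotalg_lift (f := freelift x) proper)[g gE].
by exists g => i; rewrite gE; exact: freelift_gen.
Qed.

(** Composition with the surjective projection reduces this to the free algebra. *)
Lemma free_quotalg_lrmorph_ext (f g : {lrmorphism Q -> A}) :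
  (forall i, f (quotalg_pi proper (freegen F i)) =
             g (quotalg_pi proper (freegen F i))) -> f =1 g.
Proof.
move=> fg; elim/quotalg_piW => a.
exact: (@freealg_lrmorph_ext _ _ _ (f \o quotalg_pi proper)
          (g \o quotalg_pi proper)).
Qed.

End FreeQuotient.

(** * Rescaling of equations and of commutators *)

Lemma scaler_eq_iff (F : fieldType) (V : lmodType F) (u a b a' b' : F)
    (X Y : V) :
  u != 0 -> a' = u * a -> b' = u * b ->
  a *: X = b *: Y <-> a' *: X = b' *: Y.
Proof.
move=> u0 -> ->; rewrite -!scalerA; split=> [-> //|].
exact: scalerI.
Qed.

Section Rescaling.
Context (F : comNzRingType) (A : algType F).

Lemma commmZ (c d : F) (a b : A) :
  commm (c *: a) (d *: b) = (c * d) *: commm a b.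
Proof.
by rewrite /commm -!scalerAl -!scalerAr !scalerA scalerBr (mulrC d).
Qed.

Lemma commpZ (c d : F) (a b : A) :
  commp (c *: a) (d *: b) = (c * d) *: commp a b.
Proof.
by rewrite /commp -!scalerAl -!scalerAr !scalerA scalerDr (mulrC d).
Qed.

End Rescaling.

(** * Transport of the relations along morphisms *)

Section Functoriality.
Context (R : realType) (A B : algType R[i]) (f : {lrmorphism A -> B}).
Variables (phi : 'I_3 -> R) (J : 'I_3 -> 'I_3 -> R[i]) (x : 'I_4 -> A).
Variables (k l m : 'I_3).

Lemma lrmorph_commm a b : f (commm a b) = commm (f a) (f b).
Proof. by rewrite /commm rmorphB !rmorphM. Qed.

Lemma lrmorph_commp a b : f (commp a b) = commp (f a) (f b).
Proof. by rewrite /commp rmorphD !rmorphM. Qed.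

(** This and the next three lemmas serve twice: with [f] the projection onto a quotient, and with
    [f] the evaluation [freelift x]. *)
Lemma lrmorph_R4u_rel1 :
  R4u_rel1 phi (f \o x) k l m =
  (f (R4u_rel1 phi x k l m).1, f (R4u_rel1 phi x k l m).2).
Proof. by rewrite /= !linearZ /= lrmorph_commm lrmorph_commp. Qed.

Lemma lrmorph_R4u_rel2 :
  R4u_rel2 phi (f \o x) k l m =
  (f (R4u_rel2 phi x k l m).1, f (R4u_rel2 phi x k l m).2).
Proof. by rewrite /= !linearZ /= lrmorph_commm lrmorph_commp. Qed.

Lemma lrmorph_sklyanin_rel1 :
  sklyanin_rel1 J (f \o x) k l m =
  (f (sklyanin_rel1 J x k l m).1, f (sklyanin_rel1 J x k l m).2).
Proof. by rewrite /= linearZ /= lrmorph_commm lrmorph_commp. Qed.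

Lemma lrmorph_sklyanin_rel2 :
  sklyanin_rel2 (f \o x) k l m =
  (f (sklyanin_rel2 x k l m).1, f (sklyanin_rel2 x k l m).2).
Proof. by rewrite /= linearZ /= lrmorph_commm lrmorph_commp. Qed.

End Functoriality.

(** * Universal properties of the two algebras *)

Section Presentations.
Context (R : realType) (A : algType R[i]).
Variables (phi : 'I_3 -> R) (J : 'I_3 -> 'I_3 -> R[i]) (x : 'I_4 -> A).

Let freelift_comp : freelift x \o @freegen R[i] _ = x.
Proof. by apply/funext => mu; exact: freelift_gen. Qed.

Lemma C_alg_gen_rel k l m : cyclic_perm k l m ->
  holds (R4u_rel1 phi (C_alg_gen phi) k l m) /\
  holds (R4u_rel2 phi (C_alg_gen phi) k l m).
Proof.
move=> klm; split.
  rewrite (lrmorph_R4u_rel1 (quotalg_pi (R4u_proper (phi := phi)))).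
  by apply: quotalg_pi_rel; exists k, l, m; split=> //; left.
rewrite (lrmorph_R4u_rel2 (quotalg_pi (R4u_proper (phi := phi)))).
by apply: quotalg_pi_rel; exists k, l, m; split=> //; right.
Qed.

Lemma sklyanin_gen_rel k l m : cyclic_perm k l m ->
  holds (sklyanin_rel1 J (sklyanin_gen J) k l m) /\
  holds (sklyanin_rel2 (sklyanin_gen J) k l m).
Proof.
move=> klm; split.
  rewrite (lrmorph_sklyanin_rel1 (quotalg_pi (sklyanin_proper (J := J)))).
  by apply: quotalg_pi_rel; exists k, l, m; split=> //; left.
rewrite (lrmorph_sklyanin_rel2 (quotalg_pi (sklyanin_proper (J := J)))).
by apply: quotalg_pi_rel; exists k, l, m; split=> //; right.
Qed.

Lemma C_alg_lift :
  (forall k l m, cyclic_perm k l m ->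
     holds (R4u_rel1 phi x k l m) /\ holds (R4u_rel2 phi x k l m)) ->
  exists g : {lrmorphism C_alg phi -> A}, forall mu, g (C_alg_gen phi mu) = x mu.
Proof.
move=> xP; apply: free_quotalg_lift => _ [k [l [m [/xP[x1 x2] [->|->]]]]].
  by move: x1; rewrite -{1}freelift_comp lrmorph_R4u_rel1.
by move: x2; rewrite -{1}freelift_comp lrmorph_R4u_rel2.
Qed.

Lemma sklyanin_lift :
  (forall k l m, cyclic_perm k l m ->
     holds (sklyanin_rel1 J x k l m) /\ holds (sklyanin_rel2 x k l m)) ->
  exists g : {lrmorphism sklyanin J -> A},
    forall mu, g (sklyanin_gen J mu) = x mu.
Proof.
move=> xP; apply: free_quotalg_lift => _ [k [l [m [/xP[x1 x2] [->|->]]]]].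
  by move: x1; rewrite -{1}freelift_comp lrmorph_sklyanin_rel1.
by move: x2; rewrite -{1}freelift_comp lrmorph_sklyanin_rel2.
Qed.

End Presentations.

(** * The isomorphism induced by a rescaling *)

Lemma sklyanin_C_alg_iso (R : realType) (phi : 'I_3 -> R)
    (J : 'I_3 -> 'I_3 -> R[i]) (s : 'I_4 -> R[i]) :
  (forall mu, s mu <> 0) ->
  (forall (A : algType R[i]) (x : 'I_4 -> A) k l m, cyclic_perm k l m ->
     let S := fun mu => s mu *: x mu in
     (holds (R4u_rel1 phi x k l m) <-> holds (sklyanin_rel1 J S k l m)) /\
     (holds (R4u_rel2 phi x k l m) <-> holds (sklyanin_rel2 S k l m))) ->
  exists f : {lrmorphism sklyanin J -> C_alg phi},
    bijective f /\ forall mu, f (sklyanin_gen J mu) = s mu *: C_alg_gen phi mu.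
Proof.
move=> s0 sP.
have [k l m klm|f fE] := @sklyanin_lift _ _ J (fun mu => s mu *: C_alg_gen phi mu).
  have [H1 H2] := C_alg_gen_rel phi klm.
  have [[K1 _] [K2 _]] := sP _ (C_alg_gen phi) k l m klm.
  by split; [exact: K1|exact: K2].
(* For the inverse, [sP] is applied inside the Sklyanin algebra to the elements (s^mu)^-1 S_mu,
   whose rescalings are the generators S_mu. *)
have [k l m klm|g gE] := @C_alg_lift _ _ phi (fun mu => (s mu)^-1 *: sklyanin_gen J mu).
  have [H1 H2] := sklyanin_gen_rel J klm.
  have [[_ K1] [_ K2]] := sP _ (fun mu => (s mu)^-1 *: sklyanin_gen J mu) k l m klm.
  have E : (fun mu => s mu *: ((s mu)^-1 *: sklyanin_gen J mu)) = sklyanin_gen J.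
    by apply/funext => mu; rewrite scalerA divff ?scale1r //; apply/eqP.
  by move: K1 K2; rewrite E => K1 K2; split; [exact: K1|exact: K2].
exists f; split=> //; exists g.
  (* Each composite fixes the generators, hence is the identity. *)
  apply: (free_quotalg_lrmorph_ext (f := g \o f) (g := idfun)) => mu /=.
  by rewrite [f _]fE linearZ /= gE scalerA divff ?scale1r //; apply/eqP.
apply: (free_quotalg_lrmorph_ext (f := f \o g) (g := idfun)) => mu /=.
by rewrite [g _]gE linearZ /= fE scalerA mulVf ?scale1r //; apply/eqP.
Qed.

(** * Equivalence of the relations under the rescaling *)

Section Rescale.
Context (R : realType) (phi : 'I_3 -> R) (J : 'I_3 -> 'I_3 -> R).
Variables (s : 'I_4 -> R[i]) (k l m : 'I_3).
Hypotheses (sin_neq0 : sin (phi k) <> 0) (cos_neq0 : cos (phi k) <> 0).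
Hypothesis cosB_neq0 : cos (phi l - phi m) <> 0.
Hypothesis Jlm : J l m = - tan (phi l - phi m) * tan (phi k).
Hypothesis s_neq0 : forall mu, s mu <> 0.
Hypothesis s_rel : s 0 * s (spatial k) * (cos (phi l - phi m))%:C
  + s (spatial l) * s (spatial m) * (sin (phi k))%:C = 0.

(** Put p = s^0 s^k and q = s^l s^m. Rescaling multiplies the brackets of x^0, x^k by p and those of
    x^l, x^m by q. Since q sin phi_k = - p cos(phi_l - phi_m), the first relations differ by the
    nonzero factor p / cos phi_k and the second by q / cos(phi_l - phi_m). *)
Lemma R4u_sklyanin_relE (A : algType R[i]) (x : 'I_4 -> A) :
  let S := fun mu => s mu *: x mu in
  (holds (R4u_rel1 phi x k l m) <->
     holds (sklyanin_rel1 (fun i j => (J i j)%:C) S k l m)) /\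
  (holds (R4u_rel2 phi x k l m) <-> holds (sklyanin_rel2 S k l m)).
Proof.
rewrite /= /holds /R4u_rel1 /R4u_rel2 /sklyanin_rel1 /sklyanin_rel2 /=.
rewrite !commmZ !commpZ !scalerA Jlm /tan !rmorphM rmorphN !fmorphV /=.
have p0 : s 0 * s (spatial k) != 0 by rewrite mulf_neq0 //; apply/eqP.
have q0 : s (spatial l) * s (spatial m) != 0 by rewrite mulf_neq0 //; apply/eqP.
move: s_rel p0 q0.
have : (sin (phi k))%:C != 0 by rewrite fmorph_eq0; apply/eqP.
have : (cos (phi k))%:C != 0 by rewrite fmorph_eq0; apply/eqP.
have : (cos (phi l - phi m))%:C != 0 by rewrite fmorph_eq0; apply/eqP.
set a := (sin (phi k))%:C; set c := (cos (phi k))%:C.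
set b := (sin (phi l - phi m))%:C; set d := (cos (phi l - phi m))%:C.
set p := s 0 * _; set q := s (spatial l) * _.
move=> d0 c0 a0 pdqa p0 q0.
have qE : q = - (p * d) / a.
  by apply: (canRL (mulfK a0)); apply/eqP; rewrite -addr_eq0 addrC; apply/eqP.
split.
  apply: (scaler_eq_iff (u := p / c)); first exact: mulf_neq0 (invr_neq0 c0).
    by field.
  by rewrite qE; field; rewrite ?a0 ?c0 ?d0.
apply: (scaler_eq_iff (u := q / d)); first exact: mulf_neq0 (invr_neq0 d0).
  by field.
by rewrite qE; field; rewrite ?a0 ?d0.
Qed.
End Rescale.

(** * Choice of the scalars *)

Lemma cyclic_permP (k l m : 'I_3) : cyclic_perm k l m ->
  [\/ [/\ k = 0, l = 1 & m = 2], [/\ k = 1, l = 2 & m = 0]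
    | [/\ k = 2, l = 0 & m = 1]].
Proof.
case=> -> ->; case: k => [[|[|[|//]]] lt3];
  [constructor 1|constructor 2|constructor 3];
  by split; apply/val_inj.
Qed.

(** Here [a k] and [d k] stand for sin phi_k and cos(phi_l - phi_m); the index k alone determines l
    and m. The scalars are complex because the quotients - [a k] / [d k] may be negative. *)
Lemma exists_scalars (R : realType) (a d : 'I_3 -> R) :
  (forall k, a k <> 0) -> (forall k, d k <> 0) ->
  exists s : 'I_4 -> R[i],
    (forall mu, s mu <> 0) /\
    forall k l m, cyclic_perm k l m ->
      s 0 * s (spatial k) * (d k)%:C + s (spatial l) * s (spatial m) * (a k)%:C
      = 0.
Proof.
move=> a0 d0.
pose t k : R[i] := sqrtC (- (a k)%:C / (d k)%:C).
have dC0 k : (d k)%:C != 0 by rewrite fmorph_eq0; apply/eqP/d0.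
have aC0 k : (a k)%:C != 0 by rewrite fmorph_eq0; apply/eqP/a0.
have t2 k : t k ^+ 2 = - (a k)%:C / (d k)%:C by exact: sqrtCK.
have t0 k : t k != 0.
  by rewrite sqrtC_eq0 mulf_neq0 ?oppr_eq0 ?invr_eq0.
(* [unlift] returns [None] exactly at mu = 0, which receives the product of all three roots. *)
pose s (mu : 'I_4) := if unlift ord0 mu is Some k then t k else t 0 * t 1 * t 2.
exists s; split=> [mu|k l m klm].
  by apply/eqP; rewrite /s; case: unlift => [k|] //; rewrite !mulf_neq0.
rewrite /s /spatial !liftK unlift_none.
(* A cyclic permutation lists all three indices, so the product s^0 can be reordered to bring out
   t_k ^ 2. *)
have -> : t 0 * t 1 * t 2 = t k * t l * t m.
  by case/cyclic_permP: klm => -[-> -> ->]; ring.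
have -> : t k * t l * t m * t k = t k ^+ 2 * (t l * t m) by ring.
by rewrite t2; field; exact: dC0.
Qed.

(** * The identity between the constants *)

(** The conclusion amounts to (1+u)(1+v)(1+w) = (1-u)(1-v)(1-w). With A, B, C the tangents of a, b,
    c and denominators 1+AB, 1+BC, 1+CA for u, v, w, the numerators of 1+u, 1+v, 1+w are those of
    1-v, 1-w, 1-u. The proof checks the identity after expansion in sines and cosines. *)
Lemma tan_cyclic (R : realType) (a b c : R) :
  cos a <> 0 -> cos b <> 0 -> cos c <> 0 ->
  cos (a - b) <> 0 -> cos (b - c) <> 0 -> cos (c - a) <> 0 ->
  let u := - tan (a - b) * tan c in
  let v := - tan (b - c) * tan a in
  let w := - tan (c - a) * tan b in
  u + v + w + u * v * w = 0.
Proof.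
rewrite /= /tan !sinB !cosB => /eqP a0 /eqP b0 /eqP c0 /eqP ab /eqP bc /eqP ca.
by field; rewrite a0 b0 c0 ab bc ca.
Qed.

Theorem mainTheorem5 (R : realType) (phi : 'I_3 -> R) (J : 'I_3 -> 'I_3 -> R)
    (Hphi : forall k l m : 'I_3, cyclic_perm k l m ->
       [/\ sin (phi k) <> 0, cos (phi k) <> 0 & cos (phi l - phi m) <> 0])
    (HJ : forall k l m : 'I_3, cyclic_perm k l m ->
       J l m = - tan (phi l - phi m) * tan (phi k)) :
  (exists s : 'I_4 -> R[i],
     [/\ forall mu : 'I_4, s mu <> 0,
         forall k l m : 'I_3, cyclic_perm k l m ->
           s 0 * s (spatial k) * (cos (phi l - phi m))%:C
             + s (spatial l) * s (spatial m) * (sin (phi k))%:C = 0,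
         forall (A : algType R[i]) (x : 'I_4 -> A) (k l m : 'I_3),
           cyclic_perm k l m ->
           let S := fun mu : 'I_4 => s mu *: x mu in
           (holds (R4u_rel1 phi x k l m) <->
              holds (sklyanin_rel1 (fun i j => (J i j)%:C) S k l m)) /\
           (holds (R4u_rel2 phi x k l m) <-> holds (sklyanin_rel2 S k l m))
       & exists f : {lrmorphism sklyanin (fun i j => (J i j)%:C) -> C_alg phi},
           bijective f /\
           forall mu : 'I_4,
             f (sklyanin_gen _ mu) = s mu *: C_alg_gen phi mu]) /\
  J 0 1 + J 1 2 + J 2 0 + J 0 1 * J 1 2 * J 2 0 = 0.
Proof.
have c012 : cyclic_perm 0 1 2 by split; apply/val_inj.
have c120 : cyclic_perm 1 2 0 by split; apply/val_inj.
have c201 : cyclic_perm 2 0 1 by split; apply/val_inj.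
split; last first.
  have [_ cos0 cos12] := Hphi _ _ _ c012.
  have [_ cos1 cos20] := Hphi _ _ _ c120.
  have [_ cos2 cos01] := Hphi _ _ _ c201.
  rewrite (HJ _ _ _ c012) (HJ _ _ _ c120) (HJ _ _ _ c201).
  exact: tan_cyclic.
have step k : cyclic_perm k (k + 1) (k + 2) by split.
(* Each k starts exactly one cyclic permutation, (k, k+1, k+2), so the cosine can be given as a
   function of k alone. *)
have [s [s0 srel]] := @exists_scalars R (fun k => sin (phi k))
  (fun k => cos (phi (k + 1) - phi (k + 2)))
  (fun k => let: And3 h _ _ := Hphi _ _ _ (step k) in h)
  (fun k => let: And3 _ _ h := Hphi _ _ _ (step k) in h).
have scos k l m : cyclic_perm k l m ->
    s 0 * s (spatial k) * (cos (phi l - phi m))%:C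
      + s (spatial l) * s (spatial m) * (sin (phi k))%:C = 0.
  by move=> klm; rewrite -(srel k l m klm); case: klm => -> ->.
have sE (A : algType R[i]) (x : 'I_4 -> A) k l m (klm : cyclic_perm k l m) :=
  let: And3 hs hc hB := Hphi k l m klm in
  R4u_sklyanin_relE hs hc hB (HJ k l m klm) s0 (scos k l m klm) x.
exists s; split=> //.
exact: (sklyanin_C_alg_iso s0 sE).
Qed.
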